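(* Let $k\in\mathbb N$ and let $\mathcal K$ be a proper missing-digit fractal in $[0,1]^k$ whose Cantor--Lebesgue measure $\mu$ satisfies $\dim_{\ell^1}(\mu)>k-\frac{k}{k+1}$. Then there exists $\varepsilon>0$ such that \[ \mu\big(W_k^{\mathcal K}(\tau)\big)=0\qquad\text{for all }\tau>\frac1k-\varepsilon. \]
   Context: A missing-digit fractal is a set $\mathcal K_{b,\mathcal D}=\{\sum_{j\geqslant1}\mathbf d^{(j)}b^{-j}:\mathbf d^{(j)}\in\mathcal D\}\subseteq[0,1]^k$ with integers $b\geqslant2$ and nonempty $\mathcal D\subseteq\{0,1,\dots,b-1\}^k$; its Cantor--Lebesgue measure is the law of $\sum_{j\geqslant1}\mathbf d^{(j)}b^{-j}$ with $\mathbf d^{(j)}$ i.i.d. uniform on $\mathcal D$. It is proper if $\#\mathcal K\geqslant2$ and $\mathcal K\neq[0,1]^k$. For a Borel probability measure $\nu$ on $[0,1]^k$, $\hat\nu({\boldsymbol{\xi}})=\int e^{-2\pi i{\boldsymbol{\xi}}\cdot\mathbf x}\,d\nu(\mathbf x)$ and $\dim_{\ell^1}(\nu)=\sup\{s\geqslant0:\sum_{{\boldsymbol{\xi}}\in\mathbb Z^k,\|{\boldsymbol{\xi}}\|_\infty\leqslant Q}|\hat\nu({\boldsymbol{\xi}})|\ll Q^{k-s}\ (Q\geqslant1)\}$. For $\tau>0$, $W_k^{\mathcal K}(\tau)$ is the set of $\mathbf x\in[0,1)^k$ such that \[ \max_{1\leqslant j\leqslant k}\Big|x_j-\frac{a_j}{n}\Big|<\frac{n^{-\tau}}{n}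 \] holds for infinitely many $(a_1,\dots,a_k,n)\in\mathbb Z^k\times\mathbb N$ with $(a_1/n,\dots,a_k/n)\in\mathcal K$. *)

(* Defs.v *)
From HB Require Import structures.
From mathcomp Require Import all_boot all_order all_algebra.
From mathcomp Require Import all_classical all_reals all_analysis.
Set Implicit Arguments. Unset Strict Implicit. Unset Printing Implicit Defensive.
Import Order.TTheory GRing.Theory Num.Theory.
Import numFieldNormedType.Exports.
Local Open Scope classical_set_scope.
Local Open Scope ring_scope.

(* sum_{j>=1} d^{(j)} b^{-j}, digits indexed from 0 : d j = d^{(j+1)} *)
Definition digit_series (R : realType) (k b : nat)
    (d : nat -> {ffun 'I_k -> 'I_b}) : 'I_k -> R :=
  fun i => limn (fun n : nat => \sum_(j < n) ((d j i : nat)%:R / (b%:R : R) ^+ j.+1) : R).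

Definition MD_fractal (R : realType) (k b : nat) (D : {set {ffun 'I_k -> 'I_b}})
  : set ('I_k -> R) :=
  [set y | exists d : nat -> {ffun 'I_k -> 'I_b},
             (forall j, d j \in D) /\ digit_series R d = y].

Definition proper_fractal (R : realType) (k : nat) (K : set ('I_k -> R)) : Prop :=
  (exists x y, K x /\ K y /\ x <> y) /\
  K <> [set x | forall i, 0 <= x i <= 1].

Definition iid_uniform_digits (R : realType) (dsp : measure_display)
    (T : measurableType dsp) (P : probability T R) (k b : nat)
    (D : {set {ffun 'I_k -> 'I_b}}) (dg : nat -> T -> {ffun 'I_k -> 'I_b}) : Prop :=
  forall (n : nat) (e : 'I_n -> {ffun 'I_k -> 'I_b}),
    measurable [set w | forall j : 'I_n, dg j w = e j] /\
    P [set w | forall j : 'I_n, dg j w = e j] =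
      (if [forall j, e j \in D] then ((#|D|%:R : R) ^- n)%:E else 0%E).

(* The random point sum_j dg_j b^{-j}; its law is the Cantor--Lebesgue measure. *)
Definition CL_point (R : realType) (T : Type) (k b : nat)
    (dg : nat -> T -> {ffun 'I_k -> 'I_b}) (w : T) : 'I_k -> R :=
  digit_series R (fun j => dg j w).

(* |hat mu(xi)| where mu is the law of X under P:
   hat mu(xi) = E[cos(2 pi xi.X)] - i E[sin(2 pi xi.X)]. *)
Definition fourier_abs (R : realType) (dsp : measure_display)
    (T : measurableType dsp) (P : probability T R) (k : nat)
    (X : T -> 'I_k -> R) (xi : 'I_k -> int) : R :=
  let ph := fun w => 2 * pi * \sum_(i < k) ((xi i)%:~R * X w i) in
  Num.sqrt ((Rintegral P setT (fun w => cos (ph w))) ^+ 2 +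
            (Rintegral P setT (fun w => sin (ph w))) ^+ 2).

(* sum over xi in Z^k with ||xi||_oo <= Q of |hat mu(xi)| *)
Definition l1_box_sum (R : realType) (dsp : measure_display)
    (T : measurableType dsp) (P : probability T R) (k : nat)
    (X : T -> 'I_k -> R) (Q : R) : R :=
  let N := Num.truncn Q in
  \sum_(xi : {ffun 'I_k -> 'I_(N.*2).+1} |
          [forall j, `|((xi j : nat)%:Z - N%:Z)%:~R| <= Q])
     fourier_abs P X (fun j => (xi j : nat)%:Z - N%:Z).

Definition dim_l1 (R : realType) (dsp : measure_display)
    (T : measurableType dsp) (P : probability T R) (k : nat)
    (X : T -> 'I_k -> R) : R :=
  sup [set s : R | 0 <= s /\ exists C : R, forall Q : R, 1 <= Q ->
          l1_box_sum P X Q <= C * Q `^ (k%:R - s)].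

Definition W_set (R : realType) (k : nat) (K : set ('I_k -> R)) (tau : R)
  : set ('I_k -> R) :=
  [set x | (forall i, 0 <= x i < 1) /\
     infinite_set [set an : ('I_k -> int) * nat |
        (0 < an.2)%N /\
        K (fun i => (an.1 i)%:~R / (an.2)%:R) /\
        forall i, `|x i - (an.1 i)%:~R / (an.2)%:R| < ((an.2)%:R `^ (- tau)) / (an.2)%:R]].

Arguments digit_series R {k b} d _.
Arguments MD_fractal R {k b} D _.
Arguments CL_point R {T k b} dg w _.

(* Main.v *)
Require Import Defs.
From HB Require Import structures.
From mathcomp Require Import all_boot all_order all_algebra.
From mathcomp Require Import all_classical all_reals all_analysis.
From mathcomp Require Import measurable_realfun.
From mathcomp Require Import ring lra zify.
Import Order.TTheory GRing.Theory Num.Theory.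
Import numFieldNormedType.Exports.
Local Open Scope classical_set_scope.
Local Open Scope ring_scope.

Set Implicit Arguments.
Unset Strict Implicit.
Unset Printing Implicit Defensive.

(** Write [th = k - s] for an exponent [s] admissible in [dim_l1], so
    [th < k / (k + 1)], and [q = #|D| = b ^ de] with [de < k].  At level [l] take
    the denominators [n] between [b ^ (l th)] and [b ^ ((l + 1) th)].  A rational
    point [a / n] of the fractal has a level-[l] cylinder, of measure [q ^ -l], on
    which [n X] is within [n b ^ -l] of [Z ^ k]; there a Fejer kernel of order
    [M ~ b ^ l / n] is large.  Integrating the kernel and summing over [n] leaves a
    sum of [|hat mu|] over the frequencies [n (J - J')], in which every nonzero
    frequency appears only [b ^ (l e)] times by the divisor bound.  Hence there are
    at most [q ^ l b ^ (l ((th - 1) k + th + e))] such cylinders.  Around each, the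
    points within distance [n ^ (- 1 - tau)] have measure about
    [b ^ (- de l th (1 + tau))].  At [tau = 1 / k] and [e = 0] the total exponent is
    [- (k - de) (1 - th (k + 1) / k) < 0]; it stays negative for [tau] slightly
    below [1 / k], and Borel-Cantelli over [l] concludes. *)

(** * Divisor bound: [n] has O([n ^ e]) divisors *)

Lemma size_divisors_partn (p n : nat) : (0 < n)%N -> prime p ->
  (size (divisors n) <= (logn p n).+1 * size (divisors (n`_p^')))%N.
Proof.
move=> n0 pp.
rewrite -(size_iota 0 (logn p n).+1) -(size_allpairs (fun i d => (p ^ i * d)%N)).
apply: uniq_leq_size; first exact: divisors_uniq.
move=> d; rewrite -dvdn_divisors// => dn.
have d0 : (0 < d)%N by exact: dvdn_gt0 dn.
apply/allpairsP; exists (logn p d, (d`_p^')%N); split; rewrite ?mem_iota /=.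
- by rewrite add0n ltnS dvdn_leq_log.
- by rewrite -dvdn_divisors ?part_gt0// partn_dvd.
- by rewrite -p_part partnC.
Qed.

Section DivisorBound.
Context (R : realType) (e : R).
Hypothesis e0 : 0 < e.

(** Treats a small prime through [1 + x <= expR x] at [x = e * a * ln 2]; the constant [C] makes up
    for a slope [e * ln 2] below 1. *)
Lemma natS_le_powR (a : nat) (C : R) : 1 <= C -> 1 <= C * (e * ln 2) ->
  a.+1%:R <= C * (2 `^ e) ^+ a.
Proof.
move=> C1 Ce; rewrite -powR_mulrn ?powR_ge0// -powRrM /powR.
have -> : (2 : R) == 0 = false by apply/negbTE; rewrite pnatr_eq0.
have h : 1 + e * a%:R * ln 2 <= expR (e * a%:R * ln 2) by exact: expR_ge1Dx.
have C0 : 0 <= C by lra.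
apply: (le_trans _ (ler_wpM2l C0 h)).
rewrite -natr1 mulrDr mulr1 addrC; apply: lerD => //.
have -> : C * (e * a%:R * ln 2) = (C * (e * ln 2)) * a%:R by ring.
by rewrite ler_peMl.
Qed.

(** Both the divisor count and [n ^ e] split over the [p]-part and the [p']-part, so primes can be
    stripped off one at a time, each at the cost of its own constant. *)
Lemma size_divisors_step (p n : nat) (C Cm : R) : (0 < n)%N -> prime p ->
    (forall a, a.+1%:R <= C * (p%:R `^ e) ^+ a) ->
    (size (divisors (n`_p^')%N))%:R <= Cm * ((n`_p^')%N)%:R `^ e ->
  (size (divisors n))%:R <= C * Cm * n%:R `^ e.
Proof.
move=> n0 pp hC hm.
have h : (size (divisors n))%:R
    <= (logn p n).+1%:R * (size (divisors (n`_p^')%N))%:R :> R.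
  by rewrite -natrM ler_nat size_divisors_partn.
apply: (le_trans h).
apply: (le_trans (ler_pM _ _ (hC _) hm)) => //.
rewrite -[in X in _ <= X](partnC p n0) p_part natrM powRM//.
rewrite natrX -(powR_mulrn _ (powR_ge0 _ _)) -(powR_mulrn _ (ler0n _ p)).
by rewrite powRAC mulrACA.
Qed.

(** A prime [p >= y] has [p ^ e >= 2], so [a + 1 <= 2 ^ a <= (p ^ e) ^ a] costs no constant. *)
Lemma size_divisors_large_primes (y n : nat) : 2 <= y%:R `^ e -> (0 < n)%N ->
    (forall p, prime p -> (p %| n)%N -> (y <= p)%N) ->
  (size (divisors n))%:R <= n%:R `^ e.
Proof.
move=> hy; elim/ltn_ind: n => n IH n0 hn.
have [->|n1] := eqVneq n 1%N; first by rewrite powR1.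
have n2 : (1 < n)%N by rewrite ltn_neqAle eq_sym n1.
have pp := pdiv_prime n2; set p := pdiv n in pp.
have pn : (p %| n)%N by exact: pdiv_dvd.
have hp : 2 <= p%:R `^ e.
  by apply: (le_trans hy); rewrite ge0_ler_powR ?nnegrE// ?ler_nat ?hn// ltW.
rewrite -[X in _ <= X]mul1r -[X in X * _]mul1r.
apply: (size_divisors_step n0 pp) => [a|].
  rewrite mul1r; apply: (@le_trans _ _ (2 ^+ a)).
    by rewrite -natrX ler_nat; exact: ltn_expl.
  by rewrite lerXn2r ?nnegrE ?powR_ge0.
rewrite mul1r; apply: IH.
- rewrite -[X in (_ < X)%N](partnC p n0) ltn_Pmull ?part_gt0// p_part.
  by rewrite -[X in (X < _)%N](expn0 p) ltn_exp2l ?prime_gt1// -pfactor_dvdn ?expn1.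
- exact: part_gt0.
- by move=> r rp rn; apply: hn => //; rewrite (dvdn_trans rn)// dvdn_part.
Qed.

Lemma size_divisors_bound :
  exists C : R, 0 < C /\
    forall n, (0 < n)%N -> (size (divisors n))%:R <= C * n%:R `^ e.
Proof.
have ln2 : 0 < ln (2 : R) by rewrite ln_gt0// ltr1n.
have el : 0 < e * ln 2 by rewrite mulr_gt0.
pose C := 1 + (e * ln 2)^-1.
have C1 : 1 <= C by rewrite lerDl invr_ge0 ltW.
have Ce : 1 <= C * (e * ln 2) by rewrite mulrDl mulVf ?gt_eqF// lerDr mul1r ltW.
pose y0 := (Num.truncn ((2 : R) `^ e^-1)).+1.
have hy0 : 2 <= y0%:R `^ e.
  have {1}-> : (2 : R) = (2 `^ e^-1) `^ e.
    by rewrite -powRrM mulVf ?gt_eqF// powRr1.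
  rewrite ge0_ler_powR ?nnegrE ?powR_ge0 ?(ltW e0)//.
  by rewrite ltW// truncnS_gt.
(* [t] counts the integers from [y] up to the threshold [y0], beyond which primes are free. Each
   step treats [y] itself, which costs at most one factor [C]. *)
suff H t y n : (y + t = y0)%N -> (0 < n)%N ->
    (forall p, prime p -> (p %| n)%N -> (y <= p)%N) ->
    (size (divisors n))%:R <= C ^+ t * n%:R `^ e.
  exists (C ^+ y0); split; first by rewrite exprn_gt0//; lra.
  by move=> n n0; apply: (H _ 0%N).
elim: t y n => [|t IH] y n yt n0 hn.
  rewrite expr0 mul1r; apply: (size_divisors_large_primes hy0) => //.
  by move=> p pp pn; rewrite -yt addn0 hn.
have [/andP[yp yn]|hyn] := boolP (prime y && (y %| n)%N).
  rewrite exprS; apply: (size_divisors_step n0 yp) => [a|].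
    apply: (le_trans (natS_le_powR a C1 Ce)).
    rewrite ler_wpM2l//; first lra.
    rewrite lerXn2r// ?nnegrE ?powR_ge0//.
    by rewrite ge0_ler_powR ?nnegrE// ?ler_nat ?prime_gt1// ltW.
  apply: (IH y.+1); rewrite ?part_gt0//; first by rewrite addSnnS.
  move=> p pp pn; rewrite ltn_neqAle hn// ?(dvdn_trans pn) ?dvdn_part// andbT.
  apply/eqP => yE; move: pn; rewrite -yE => yd.
  have := part_pnat (y^')%N n; move=> /pnatP/(_ _ yp yd).
  by rewrite part_gt0 => /(_ isT); rewrite !inE eqxx.
apply: (@le_trans _ _ (C ^+ t * n%:R `^ e)).
  apply: (IH y.+1) => //; first by rewrite addSnnS.
  move=> p pp pn; rewrite ltn_neqAle hn// andbT.
  by apply: contra hyn => /eqP ->; rewrite pp.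
by rewrite ler_wpM2r ?powR_ge0// ler_weXn2l.
Qed.
End DivisorBound.

(** * Base-[b] expansions and their truncations *)

Section DigitCode.
Context (R : realType) (k b : nat).
Hypothesis b2 : (2 <= b)%N.
Implicit Types (d : nat -> {ffun 'I_k -> 'I_b}) (i : 'I_k) (m n : nat).

(* The integer with base-[b] digits [d 0 i, ..., d (m - 1) i], leading digit
   first, i.e. [b ^ m] times the truncation of the expansion at level [m]. *)
Fixpoint digit_code d m i : nat :=
  if m is m'.+1 then b * digit_code d m' i + d m' i else 0.

Lemma digit_code_lt d m i : (digit_code d m i < b ^ m)%N.
Proof.
elim: m => [|m IH] /=; first by rewrite expn0.
rewrite expnS; apply: (@leq_trans (b * (digit_code d m i).+1)%N).
  by rewrite mulnS addnC ltn_add2r.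
by rewrite leq_mul2l IH orbT.
Qed.

Lemma digit_code_inj d d' m : (forall i, digit_code d m i = digit_code d' m i) ->
  forall j, (j < m)%N -> d j = d' j.
Proof.
elim: m => // m IH h j; rewrite ltnS leq_eqVlt => /predU1P[->|].
  apply/ffunP => i; apply/val_inj; have := congr1 (modn^~ b) (h i).
  by rewrite /= !(mulnC b) !modnMDl !modn_small.
apply: IH => i; have := congr1 (divn^~ b) (h i).
by rewrite /= !(mulnC b) !divnMDl ?(divn_small (ltn_ord _)) ?addn0; do ?exact: leq_trans b2.
Qed.

Lemma eq_digit_code d d' m : (forall j, (j < m)%N -> d j = d' j) ->
  forall i, digit_code d m i = digit_code d' m i.
Proof.
elim: m => // m IH h i /=; rewrite h// IH// => j jm.
by apply: h; rewrite ltnS ltnW.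
Qed.

Lemma digit_code_divn d m n i :
  digit_code d m i = (digit_code d (m + n) i %/ b ^ n)%N.
Proof.
elim: n => [|n IH]; first by rewrite addn0 divn1.
rewrite addnS /= expnS divnMA (mulnC b) divnMDl; last exact: leq_trans b2.
by rewrite (divn_small (ltn_ord _)) addn0.
Qed.

Let bR : 0 < b%:R :> R. Proof. by rewrite ltr0n; apply: leq_trans b2. Qed.
Let bX m : 0 < b%:R ^+ m :> R. Proof. exact: exprn_gt0. Qed.

Lemma digit_code_sum d n i :
  \sum_(j < n) ((d j i : nat)%:R / b%:R ^+ j.+1) = (digit_code d n i)%:R / b%:R ^+ n :> R.
Proof.
elim: n => [|n IH]; first by rewrite big_ord0 mul0r.
rewrite big_ord_recr /= IH natrD natrM mulrDl; congr +%R.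
by rewrite exprS -mulf_div divff ?gt_eqF// mul1r.
Qed.

Lemma digit_code_le d m n i : (m <= n)%N ->
  (digit_code d m i)%:R / b%:R ^+ m <= (digit_code d n i)%:R / b%:R ^+ n :> R.
Proof.
move=> mn; rewrite -(subnKC mn) (digit_code_divn d m (n - m)) exprD.
set c := digit_code _ _ _.
rewrite invfM (mulrC (b%:R ^+ m)^-1) mulrA ler_wpM2r ?invr_ge0 ?(ltW (bX _))//.
by rewrite ler_pdivlMr// -natrX -natrM ler_nat leq_trunc_div.
Qed.

Lemma digit_code_ge d m n i : (m <= n)%N ->
  (digit_code d n i)%:R / b%:R ^+ n <= (digit_code d m i).+1%:R / b%:R ^+ m :> R.
Proof.
move=> mn; rewrite -(subnKC mn) (digit_code_divn d m (n - m)) exprD.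
set c := digit_code _ _ _.
rewrite invfM (mulrC (b%:R ^+ m)^-1) mulrA ler_wpM2r ?invr_ge0 ?(ltW (bX _))//.
rewrite ler_pdivrMr// -natrX -natrM ler_nat ltnW// ltn_ceil// expn_gt0.
by rewrite (leq_trans _ b2).
Qed.

Lemma digit_series_cvg d i :
  (fun n : nat => \sum_(j < n) ((d j i : nat)%:R / (b%:R : R) ^+ j.+1) : R)
    @ \oo --> digit_series R d i.
Proof.
apply: nondecreasing_is_cvgn.
  by move=> m n mn; rewrite !digit_code_sum; exact: digit_code_le.
exists 1 => _ [n _ <-]; rewrite digit_code_sum ler_pdivrMr// mul1r -natrX ler_nat.
exact/ltnW/digit_code_lt.
Qed.

Lemma digit_series_ge d m i :
  (digit_code d m i)%:R / b%:R ^+ m <= digit_series R d i.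
Proof.
apply: limr_ge; first by apply: cvgP; exact: digit_series_cvg.
near=> n; rewrite digit_code_sum; apply: digit_code_le.
by near: n; exact: nbhs_infty_ge.
Unshelve. all: by end_near. Qed.

Lemma digit_series_le d m i :
  digit_series R d i <= (digit_code d m i).+1%:R / b%:R ^+ m.
Proof.
apply: limr_le; first by apply: cvgP; exact: digit_series_cvg.
near=> n; rewrite digit_code_sum; apply: digit_code_ge.
by near: n; exact: nbhs_infty_ge.
Unshelve. all: by end_near. Qed.

(** Both points lie in the same closed [b]-adic interval of level [m]. *)
Lemma digit_series_dist d d' m i :
    digit_code d m i = digit_code d' m i ->
  `|digit_series R d i - digit_series R d' i| <= (b%:R ^+ m)^-1.
Proof.
move=> dd'; have h : (digit_code d m i).+1%:R / b%:R ^+ m =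
    (digit_code d m i)%:R / b%:R ^+ m + (b%:R ^+ m)^-1 :> R.
  by rewrite -natr1 mulrDl mul1r.
have := digit_series_ge d m i; have := digit_series_le d m i.
have := digit_series_ge d' m i; have := digit_series_le d' m i.
rewrite -dd' h ler_norml => *; apply/andP; split; lra.
Qed.

(** The strict hypothesis yields a strict [c < c' + 2] between the two codes. Applied both ways, it
    leaves three possible neighbours per coordinate. *)
Lemma digit_code_near d d' m i :
    `|digit_series R d i - digit_series R d' i| < (b%:R ^+ m)^-1 ->
  (digit_code d m i <= (digit_code d' m i).+1)%N.
Proof.
move=> h; have := digit_series_ge d m i; have := digit_series_le d' m i.
rewrite -ltnS -(ltr_nat R) -[_.+2%:R]natr1 => h1 h2.
rewrite -(ltr_pM2r (_ : 0 < (b%:R ^+ m)^-1)) ?invr_gt0// mulrDl mul1r.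
move: h; rewrite ltr_norml => /andP[_ h]; lra.
Qed.

End DigitCode.

(** * The full digit set gives the whole cube *)

Section FullDigits.
Context (R : realType) (b : nat).
Hypothesis b2 : (2 <= b)%N.

(** The cap at [b - 1] matters only at [r = 1], which is thereby expanded with all digits
    [b - 1]. *)
Definition greedy_digit (r : R) : nat := minn b.-1 (Num.truncn (b%:R * r)).

Definition greedy_step (r : R) : R := b%:R * r - (greedy_digit r)%:R.

Lemma greedy_stepP (r : R) : 0 <= r <= 1 -> 0 <= greedy_step r <= 1.
Proof.
move=> /andP[r0 r1]; have b0 : (0 < b)%N by exact: leq_trans b2.
have br0 : 0 <= b%:R * r by rewrite mulr_ge0.
have := truncn_itv br0; rewrite /greedy_step /greedy_digit.
case: leqP => [hb|hb] /andP[h1 h2].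
  have : b.-1%:R <= (Num.truncn (b%:R * r))%:R :> R by rewrite ler_nat.
  have : b%:R * r <= b%:R by rewrite ler_piMr.
  rewrite -[X in _ <= X%:R](prednK b0) -natr1 => *; lra.
by rewrite -natr1 in h2; lra.
Qed.

Lemma greedy_digit_lt (r : R) : (greedy_digit r < b)%N.
Proof. by rewrite /greedy_digit; lia. Qed.

(** Used by contraposition: a fractal other than the cube must omit a digit vector. *)
Lemma MD_fractal_setT (k : nat) :
  MD_fractal R [set: {ffun 'I_k -> 'I_b}]%SET = [set x | forall i, 0 <= x i <= 1].
Proof.
have bX m : 0 < b%:R ^+ m :> R.
  by rewrite exprn_gt0// ltr0n; apply: leq_trans b2.
apply/seteqP; split => [_ [d [_ <-]] i|x x01].
  have := digit_series_ge R b2 d 0 i; have := digit_series_le R b2 d 0 i.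
  by rewrite /= expr0 !divr1 => -> ->.
pose r i n := iter n greedy_step (x i).
have r01 i n : 0 <= r i n <= 1.
  by elim: n => [|n IH]; [exact: x01|exact: greedy_stepP].
pose d n : {ffun 'I_k -> 'I_b} := [ffun i => Ordinal (greedy_digit_lt (r i n))].
exists d; split => [j|]; first by rewrite inE.
(* Invariant of the greedy algorithm: the remainder stays in [0, 1], so [x] and its series agree up
   to [b ^ -n] for every [n]. *)
have code n i : x i * b%:R ^+ n = (digit_code d n i)%:R + r i n.
  elim: n => [|n IH]; first by rewrite mulr1 add0r.
  rewrite /= exprS mulrCA IH natrD natrM ffunE/= /greedy_step; ring.
apply/funext => i; apply/eqP; rewrite -subr_eq0 -normr_le0.
apply/ler_addgt0Pr => e e0; rewrite add0r.
have [n hn] : exists n, (b%:R ^+ n)^-1 < e :> R.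
  exists (Num.truncn e^-1).+1; rewrite invf_plt ?posrE//.
  apply: (lt_trans (truncnS_gt _)); rewrite -natrX ltr_nat; exact: ltn_expl.
apply: (le_trans _ (ltW hn)).
have := digit_series_ge R b2 d n i; have := digit_series_le R b2 d n i.
have -> : x i = ((digit_code d n i)%:R + r i n) / b%:R ^+ n.
  by rewrite -code mulfK// gt_eqF.
rewrite -natr1 !mulrDl mul1r => h1 h2.
have /andP[rn0 rn1] := r01 i n.
have g0 : 0 <= r i n / b%:R ^+ n by rewrite divr_ge0// ltW.
have g1 : r i n / b%:R ^+ n <= (b%:R ^+ n)^-1.
  by rewrite ler_piMl// invr_ge0 ltW.
rewrite ler_norml; apply/andP; split; lra.
Qed.

End FullDigits.

(** * Finite unions and finite sums under a probability measure *)

Section FiniteSums.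
Context (R : realType) (dsp : measure_display) (T : measurableType dsp).
Context (P : probability T R) (I : Type).

Lemma measure_bigsetU_le (s : seq I) (Q : pred I) (F : I -> set T) :
    (forall i, measurable (F i)) ->
  (P (\big[setU/set0]_(i <- s | Q i) F i) <= \sum_(i <- s | Q i) P (F i))%E.
Proof.
move=> mF; elim: s => [|i s IH]; first by rewrite !big_nil measure0.
rewrite !big_cons; case: ifPn => // _.
apply: (le_trans (measureU2 _ _ _)) => //; last by rewrite leeD2l.
exact: bigsetU_measurable.
Qed.

Lemma bounded_integrable (f : T -> R) (c : R) : measurable_fun setT f ->
  (forall w, `|f w| <= c) -> P.-integrable setT (EFin \o f).
Proof.
move=> mf fc; apply: measurable_bounded_integrable => //.
  by rewrite -ge0_fin_numE// fin_num_measure.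
exists c; split; first exact: num_real.
by move=> x cx w _ /=; apply: (le_trans (fc w)); exact: ltW.
Qed.

Lemma Rintegral_sum (s : seq I) (Q : pred I) (f : I -> T -> R) :
    (forall i, P.-integrable setT (EFin \o f i)) ->
  \int[P]_w (\sum_(i <- s | Q i) f i w) = \sum_(i <- s | Q i) \int[P]_w f i w.
Proof.
move=> fi; elim: s => [|i s IH].
  by under eq_Rintegral do rewrite big_nil; rewrite big_nil Rintegral_cst// mul0r.
rewrite big_cons -IH; case: ifPn => Qi; last first.
  by apply: eq_Rintegral => w _; rewrite big_cons (negbTE Qi).
rewrite -RintegralD//; first by apply: eq_Rintegral => w _; rewrite big_cons Qi.
rewrite (_ : _ \o _ = fun w => (\sum_(j <- s | Q j) (f j w)%:E)%E).
  by apply: integrable_sum => // j _; exact: fi.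
by apply/funext => w /=; rewrite sumEFin.
Qed.

End FiniteSums.

(** * Cylinders, their measure, and measurability of the random point *)

Section Cylinders.
Context (R : realType) (k b : nat) (D : {set {ffun 'I_k -> 'I_b}}).
Context (dsp : measure_display) (T : measurableType dsp) (P : probability T R).
Context (dg : nat -> T -> {ffun 'I_k -> 'I_b}).
Hypothesis b2 : (2 <= b)%N.
Hypothesis iid : iid_uniform_digits P D dg.

(** Indexing by integer codes instead of digit words makes neighbouring cells reachable by
    arithmetic on [V]; a [V] that is never attained gives the empty set. *)
Definition cylinder (m : nat) (V : 'I_k -> nat) : set T :=
  [set w | forall i, digit_code (fun j => dg j w) m i = V i].

Lemma cylinderE m (d : nat -> {ffun 'I_k -> 'I_b}) :
  cylinder m (digit_code d m) = [set w | forall j : 'I_m, dg j w = d j].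
Proof.
apply/seteqP; split => w h; first by move=> j; apply: (digit_code_inj b2 h).
by apply: eq_digit_code => j jm; exact: (h (Ordinal jm)).
Qed.

Lemma cylinder_cases m V :
  cylinder m V = set0 \/ exists d : nat -> {ffun 'I_k -> 'I_b}, V = digit_code d m.
Proof.
have [->|/set0P[w wV]] := eqVneq (cylinder m V) set0; [by left|right].
by exists (dg^~ w); apply/funext => i; rewrite wV.
Qed.

Lemma measurable_cylinder m V : measurable (cylinder m V).
Proof.
have [->//|[d ->]] := cylinder_cases m V; rewrite cylinderE.
exact: (iid (fun j : 'I_m => d j)).1.
Qed.

Lemma measure_cylinder m (d : nat -> {ffun 'I_k -> 'I_b}) :
  (forall j, d j \in D) -> P (cylinder m (digit_code d m)) = ((#|D|%:R : R) ^- m)%:E.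
Proof.
move=> dD; rewrite cylinderE (iid (fun j : 'I_m => d j)).2.
by case: forallP => // -[] j.
Qed.

Lemma measure_cylinder_le m V : (P (cylinder m V) <= ((#|D|%:R : R) ^- m)%:E)%E.
Proof.
have D0 : 0 <= (#|D|%:R : R) ^- m by rewrite invr_ge0 exprn_ge0.
have [->|[d ->]] := cylinder_cases m V; first by rewrite measure0 lee_fin.
by rewrite cylinderE (iid (fun j : 'I_m => d j)).2; case: ifP; rewrite lee_fin.
Qed.

(** Codes at level [m] lie below [b ^ m], so a preimage is a finite union of cylinders, and these
    are the events that [iid_uniform_digits] declares measurable. *)
Lemma measurable_digit_code m i :
  measurable_fun setT (fun w => (digit_code (dg^~ w) m i)%:R : R).
Proof.
move=> _ Y mY; rewrite setTI.
rewrite (_ : _ @^-1` _ =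
  \bigcup_(V in [set V : {ffun 'I_k -> 'I_(b ^ m)} | Y (V i : nat)%:R])
     cylinder m (fun j => V j)).
  by apply: fin_bigcup_measurable => // V _; exact: measurable_cylinder.
apply/seteqP; split => w /=; last by move=> [V YV wV]; rewrite wV.
move=> Yw; exists [ffun j => Ordinal (digit_code_lt (dg^~ w) m j)] => /=.
  by rewrite ffunE.
by move=> j; rewrite ffunE.
Qed.

Lemma measurable_CL_point i : measurable_fun setT (fun w => CL_point R dg w i).
Proof.
apply: (@measurable_fun_cvg _ _ _ _
    (fun n w => \sum_(j < n) ((dg j w i : nat)%:R / (b%:R : R) ^+ j.+1)))
  => [n|w _]; last first.
  exact: (@digit_series_cvg R k b b2 (dg^~ w) i).
rewrite (_ : (fun w => _) = (fun w => (digit_code (dg^~ w) n i)%:R / b%:R ^+ n)).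
  by apply: measurable_funM => //; exact: measurable_digit_code.
by apply/funext => w; rewrite -digit_code_sum.
Qed.

End Cylinders.

(** * Multiplicity of the frequencies [n (J - J')] *)

Section ScaledDifferences.
Context (R : realType) (k N M : nat) (f : ('I_k -> int) -> R) (B : R).
Hypothesis f0 : forall xi, 0 <= f xi.
Hypothesis B0 : 0 <= B.
Hypothesis divB : forall m : nat, (0 < m <= N * M)%N -> (size (divisors m))%:R <= B.
Implicit Types J : {ffun 'I_k -> 'I_M}.

(* A nonzero frequency [xi] is hit as [n * (J - J')] at most once for each
   [n] dividing a fixed nonzero coordinate of [xi]. *)
Lemma sum_scaled_differences_neq J :
  \sum_(n < N) \sum_(J' : {ffun 'I_k -> 'I_M} | J' != J)
     f (fun i => n.+1%:Z * ((J i : nat)%:Z - (J' i : nat)%:Z))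
  <= B * \sum_(xi : {ffun 'I_k -> 'I_((N * M).*2).+1})
           f (fun i => (xi i : nat)%:Z - (N * M)%N%:Z).
Proof.
pose H := (N * M)%N.
(* The frequency is shifted by [H] to become a natural number; the subtraction is exact because
   [n * J' <= H]. *)
pose g (p : 'I_N * {ffun 'I_k -> 'I_M}) : {ffun 'I_k -> 'I_(H.*2).+1} :=
  [ffun i => inord (H + p.1.+1 * J i - p.1.+1 * p.2 i)%N].
have le_H (n : 'I_N) (j : 'I_M) : (n.+1 * j <= H)%N.
  by rewrite leq_mul// ltnW.
have gE p i : (g p i : nat)%:Z - H%:Z =
    p.1.+1%:Z * ((J i : nat)%:Z - (p.2 i : nat)%:Z).
  have h1 := le_H p.1 (p.2 i); have h2 := le_H p.1 (J i).
  by rewrite ffunE inordK; lia.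
rewrite pair_big/= (partition_big g xpredT)//= mulr_sumr; apply: ler_sum => xi _.
rewrite (eq_bigr (fun=> f (fun i => (xi i : nat)%:Z - H%:Z))); last first.
  by move=> p /andP[_ /eqP <-]; congr f; apply/funext => i; rewrite gE.
pose A := [set p | (p.2 != J) && (g p == xi)]%SET.
rewrite (eq_bigl (fun p => p \in A)); last by move=> p; rewrite inE.
rewrite sumr_const -mulr_natl ler_wpM2r//.
have [A0|[p0]] := set_0Vmem A; first by rewrite A0 cards0.
rewrite inE => /andP[p0J /eqP p0xi].
(* The coordinate [i0] is chosen from one member of the fibre [A] of [g] over [xi], but
   [m = |xi i0|] depends on [xi] only, so every [n] occurring in [A] divides this one positive
   integer. *)
have [i0 i0J] : exists i, p0.2 i != J i.
  apply/existsP; rewrite -negb_forall; apply: contra p0J => /forallP h.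
  by apply/eqP/ffunP => i; apply/eqP.
pose m := `|(xi i0 : nat)%:Z - H%:Z|%N.
have mE p : p \in A -> m = (p.1.+1 * `|(J i0 : nat)%:Z - (p.2 i0 : nat)%:Z|)%N.
  by rewrite inE => /andP[_ /eqP pxi]; rewrite /m -pxi gE abszM.
have p0A : p0 \in A by rewrite inE p0J p0xi/=.
have m0 : (0 < m)%N.
  rewrite (mE _ p0A) muln_gt0/= absz_gt0 subr_eq0 eqz_nat eq_sym.
  by apply: contra i0J => /eqP h; apply/eqP/val_inj.
have mH : (m <= H)%N.
  rewrite (mE _ p0A); apply: leq_mul => //.
  by have := ltn_ord (J i0); have := ltn_ord (p0.2 i0); lia.
apply: le_trans (divB (m := m) _); last by rewrite m0.
(* Given [xi] and [J], the factor [n] determines [J'], so the fibre injects into the divisors of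
   [m]. *)
rewrite ler_nat -(size_image (fun p : 'I_N * {ffun 'I_k -> 'I_M} => p.1.+1)).
apply: uniq_leq_size; last first.
  by move=> _ /mapP[p + ->]; rewrite mem_enum => pA; rewrite -dvdn_divisors// (mE _ pA) dvdn_mulr.
rewrite map_inj_in_uniq ?enum_uniq// => p p'; rewrite !mem_enum !inE.
move=> /andP[_ /eqP pxi] /andP[_ /eqP p'xi] [] /val_inj pp'.
move: p p' pp' pxi p'xi => [n J1] [n' J2] /= <- pxi p'xi; congr pair.
apply/ffunP => i; apply/val_inj.
have := gE (n, J1) i; have := gE (n, J2) i; rewrite pxi p'xi /= => -> /eqP.
rewrite -subr_eq0 -mulrBr mulf_eq0/= => /eqP; lia.
Qed.

(** The diagonal [J' = J] gives the term [N * f 0]; the off-diagonal bound holds for each of the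
    [M ^ k] choices of [J]. *)
Lemma sum_scaled_differences :
  \sum_(n < N) \sum_(J : {ffun 'I_k -> 'I_M}) \sum_(J' : {ffun 'I_k -> 'I_M})
     f (fun i => n.+1%:Z * ((J i : nat)%:Z - (J' i : nat)%:Z))
  <= (M ^ k)%:R * (N%:R * f (fun=> 0) +
       B * \sum_(xi : {ffun 'I_k -> 'I_((N * M).*2).+1})
             f (fun i => (xi i : nat)%:Z - (N * M)%N%:Z)).
Proof.
rewrite exchange_big/=; set S := (X in _ <= _ * X).
have -> : (M ^ k)%:R * S = \sum_(J : {ffun 'I_k -> 'I_M}) S.
  by rewrite sumr_const card_ffun !card_ord mulr_natl.
apply: ler_sum => J _.
under eq_bigr do rewrite (bigD1 J)//=.
rewrite big_split/= lerD ?sum_scaled_differences_neq//.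
rewrite (eq_bigr (fun=> f (fun=> 0))).
  by rewrite sumr_const card_ord mulr_natl.
by move=> n _; congr f; apply/funext => i; rewrite subrr mulr0.
Qed.

End ScaledDifferences.

(** * The Fejer kernel: expansion, integral and lower bound *)

Section Energy.
Context (R : realType) (k b : nat) (D : {set {ffun 'I_k -> 'I_b}}).
Context (dsp : measure_display) (T : measurableType dsp) (P : probability T R).
Context (dg : nat -> T -> {ffun 'I_k -> 'I_b}).
Hypothesis b2 : (2 <= b)%N.
Hypothesis iid : iid_uniform_digits P D dg.
Let X := CL_point R dg.

Lemma cos_int_shift (x y : R) (z : int) : x = y + pi *+ 2 *~ z -> cos x = cos y.
Proof.
move=> ->; case: z => n; first by rewrite (periodicn (@cosD2pi R)).
rewrite NegzE mulrNz -[in RHS](subrK (pi *+ 2 *+ n.+1) y).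
by rewrite (periodicn (@cosD2pi R)).
Qed.

Lemma cos_near_int (x : R) (z : int) : `|x - z%:~R| <= 8^-1 ->
  2^-1 <= cos (2 * pi * x).
Proof.
move=> xz; rewrite (@cos_int_shift _ (2 * pi * (x - z%:~R)) z); last first.
  by rewrite -mulrzl -mulr_natl; ring.
set y := 2 * pi * _.
have p0 := pi_gt0 R.
have yp : `|y| <= pi / 4.
  rewrite !normrM (ger0_norm (ltW p0)) ger0_norm//.
  have -> : pi / 4 = 2 * pi * 8^-1 :> R by field.
  by rewrite ler_wpM2l// mulr_ge0// ltW.
have c0 : 0 <= cos y.
  apply: cos_ge0_pihalf; rewrite -ler_norml (le_trans yp)//; lra.
(* From [cos (2 y) >= 0] follows [cos y ^ 2 >= 1 / 2], and [cos y] lies in [0, 1], so it dominates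
   its square. *)
have : 0 <= cos (y *+ 2).
  apply: cos_ge0_pihalf; rewrite -ler_norml -mulr_natl normrM ger0_norm//; lra.
rewrite cos_mulr2n -mulr_natl => h; have := cos_le1 y; nra.
Qed.

Definition phase (xi : 'I_k -> int) (w : T) : R :=
  2 * pi * \sum_(i < k) ((xi i)%:~R * X w i).

Lemma measurable_phase xi : measurable_fun setT (phase xi).
Proof.
apply: measurable_funM => //; apply: measurable_sum => i.
by apply: measurable_funM => //; exact: measurable_CL_point.
Qed.

Lemma integrable_cos_phase xi : P.-integrable setT (EFin \o (fun w => cos (phase xi w))).
Proof.
apply: (@bounded_integrable _ _ _ _ _ 1) => [|w]; last exact: cos_max.
apply: measurableT_comp; last exact: measurable_phase.
by apply: continuous_measurable_fun; exact: continuous_cos.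
Qed.

Lemma Rintegral_cos_le xi :
  \int[P]_w cos (phase xi w) <= fourier_abs P X xi.
Proof.
apply: (le_trans (ler_norm _)); rewrite -sqrtr_sqr ler_wsqrtr// lerDl.
exact: sqr_ge0.
Qed.

Lemma fourier_abs_ge0 xi : 0 <= fourier_abs P X xi.
Proof. exact: sqrtr_ge0. Qed.

Lemma fourier_abs0 : fourier_abs P X (fun=> 0) = 1.
Proof.
have ph0 w : 2 * pi * (\sum_(i < k) (0%:~R * X w i)) = 0.
  by rewrite big1 ?mulr0// => i _; rewrite mul0r.
rewrite /fourier_abs.
under eq_Rintegral do rewrite ph0 cos0.
under [X in _ + X ^+ 2]eq_Rintegral do rewrite ph0 sin0.
rewrite !Rintegral_cst// mul0r expr0n addr0 mul1r.
have -> : fine (P setT) = 1 by rewrite (@probability_setT _ _ _ P).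
by rewrite expr1n sqrtr1.
Qed.

(* [M ^ - k * energy n M] is the Fejer kernel of order [M] evaluated at [n X]. *)
Definition energy (n M : nat) (w : T) : R :=
  (\sum_(J : {ffun 'I_k -> 'I_M}) cos (phase (fun i => n%:Z * (J i : nat)%:Z) w)) ^+ 2 +
  (\sum_(J : {ffun 'I_k -> 'I_M}) sin (phase (fun i => n%:Z * (J i : nat)%:Z) w)) ^+ 2.

(** The squared modulus of an exponential sum, expanded by the formula for [cos (x - y)]. Only
    cosines remain, so bounding a real part by [|hat mu|] will suffice. *)
Lemma energyE n M w : energy n M w =
  \sum_(J : {ffun 'I_k -> 'I_M}) \sum_(J' : {ffun 'I_k -> 'I_M})
    cos (phase (fun i => n%:Z * ((J i : nat)%:Z - (J' i : nat)%:Z)) w).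
Proof.
rewrite /energy !expr2 !big_distrlr -big_split/=; apply: eq_bigr => J _.
rewrite -big_split/=; apply: eq_bigr => J' _; rewrite -cosB; congr cos.
rewrite /phase -mulrBr -sumrB; congr (_ * _); apply: eq_bigr => i _.
by rewrite -mulrBl mulrBr rmorphB.
Qed.

Lemma integrable_energy n M : P.-integrable setT (EFin \o energy n M).
Proof.
rewrite (_ : _ \o _ = fun w =>
  (\sum_(J : {ffun 'I_k -> 'I_M}) \sum_(J' : {ffun 'I_k -> 'I_M})
    (cos (phase (fun i => n%:Z * ((J i : nat)%:Z - (J' i : nat)%:Z)) w))%:E)%E).
  apply: integrable_sum => // J _; apply: integrable_sum => // J' _.
  exact: integrable_cos_phase.
apply/funext => w /=; rewrite energyE -sumEFin.
by apply: eq_bigr => J _; rewrite sumEFin.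
Qed.

Lemma Rintegral_energy_le n M : \int[P]_w energy n M w <=
  \sum_(J : {ffun 'I_k -> 'I_M}) \sum_(J' : {ffun 'I_k -> 'I_M})
    fourier_abs P X (fun i => n%:Z * ((J i : nat)%:Z - (J' i : nat)%:Z)).
Proof.
under eq_Rintegral do rewrite energyE pair_big/=.
rewrite pair_big/= Rintegral_sum => [|p]; last exact: integrable_cos_phase.
by apply: ler_sum => p _; exact: Rintegral_cos_le.
Qed.

(** The inner product of [J] with [n X] is within [k M e <= 1 / 8] of an integer, so each of the
    [M ^ k] cosines is at least 1/2. *)
Lemma energy_lower n M (e : R) (w : T) (a : 'I_k -> int) :
    0 <= e -> k%:R * M%:R * e <= 8^-1 ->
    (forall i, `|n%:R * X w i - (a i)%:~R| <= e) ->
  ((M ^ k)%:R) ^+ 2 <= 4 * energy n M w.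
Proof.
move=> e0 eM aX.
have h (J : {ffun 'I_k -> 'I_M}) :
    2^-1 <= cos (phase (fun i => n%:Z * (J i : nat)%:Z) w).
  apply: (@cos_near_int _ (\sum_(i < k) ((J i : nat)%:Z * a i))).
  rewrite rmorph_sum/= -sumrB (le_trans (ler_norm_sum _ _ _))//.
  apply: (le_trans _ eM); rewrite -mulrA.
  rewrite (_ : k%:R * _ = \sum_(i < k) (M%:R * e)); last first.
    by rewrite sumr_const card_ord mulr_natl.
  apply: ler_sum => i _.
  rewrite !rmorphM/= mulrAC mulrC -mulrBr normrM.
  apply: ler_pM => //; rewrite -pmulrn normr_nat ler_nat.
  exact: ltnW.
have S : (M ^ k)%:R / 2 <=
    \sum_(J : {ffun 'I_k -> 'I_M}) cos (phase (fun i => n%:Z * (J i : nat)%:Z) w).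
  rewrite (_ : _ / 2 = \sum_(J : {ffun 'I_k -> 'I_M}) 2^-1); last first.
    by rewrite sumr_const card_ffun !card_ord mulr_natl.
  by apply: ler_sum => J _.
rewrite /energy; set c := \sum_J _ in S *; set s := \sum_J _.
have M0 : 0 <= (M ^ k)%:R :> R by [].
have s0 := sqr_ge0 s.
have : ((M ^ k)%:R / 2) ^+ 2 <= c ^+ 2.
  by rewrite lerXn2r// nnegrE ?divr_ge0// (le_trans _ S)// divr_ge0.
rewrite exprMn; lra.
Qed.

End Energy.

(** * Counting the cylinders of rational points, and covering their neighbourhoods *)

Section Covering.
Context (R : realType) (k b : nat) (D : {set {ffun 'I_k -> 'I_b}}).
Context (dsp : measure_display) (T : measurableType dsp) (P : probability T R).
Context (dg : nat -> T -> {ffun 'I_k -> 'I_b}).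
Hypothesis b2 : (2 <= b)%N.
Hypothesis D0 : D != finset.set0.
Hypothesis iid : iid_uniform_digits P D dg.
Let X := CL_point R dg.
Let q : R := #|D|%:R.

Let q0 : 0 < q. Proof. by rewrite ltr0n card_gt0. Qed.

Lemma l1_box_sum_nat (H : nat) : l1_box_sum P X H%:R =
  \sum_(xi : {ffun 'I_k -> 'I_(H.*2).+1})
    fourier_abs P X (fun j => (xi j : nat)%:Z - H%:Z).
Proof.
rewrite /l1_box_sum natrK; apply: eq_bigl => xi; apply/forallP => j.
rewrite -intr_norm -[H%:R]/(H%:Z%:~R) ler_int ler_norml.
have := ltn_ord (xi j); move: (nat_of_ord _) => x; rewrite ltnS => xH.
by rewrite lerBrDr addNr lerBlDr -PoszD addnn !lez_nat.
Qed.

(** Every admissible expansion counts: a rational point with two expansions may contribute two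
    codes. *)
Definition rat_codes (n l : nat) : {set {ffun 'I_k -> 'I_(b ^ l)}} :=
  [set V : {ffun 'I_k -> 'I_(b ^ l)} |
    `[< exists (a : 'I_k -> int) (d : nat -> {ffun 'I_k -> 'I_b}),
          [/\ forall j, d j \in D,
              digit_series R d = (fun i => (a i)%:~R / n%:R)
            & forall i, V i = digit_code d l i :> nat] >]]%SET.

(** A Chebyshev-type argument: the kernel is large on each of these cylinders, and they are disjoint
    of measure [q ^ -l]. On a cylinder [|X - a / n| <= b ^ -l], which gives [e = n / b ^ l] in
    [energy_lower]. *)
Lemma card_rat_codes (n l M : nat) : (0 < n)%N ->
    k%:R * M%:R * (n%:R / b%:R ^+ l) <= 8^-1 :> R ->
  #|rat_codes n l|%:R * q ^- l * ((M ^ k)%:R) ^+ 2 <= 4 * \int[P]_w energy R dg n M w.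
Proof.
move=> n0 hM.
have n0R : n%:R != 0 :> R by rewrite pnatr_eq0 -lt0n.
have mcyl V : measurable (cylinder dg l V) by exact: measurable_cylinder.
have icyl V : P.-integrable setT (EFin \o \1_(cylinder dg l V)).
  exact: integrable_indic.
(* Distinct codes have disjoint cylinders, so [S] takes only the values 0 and 1. *)
pose S w : R := \sum_(V in rat_codes n l) \1_(cylinder dg l (fun i => V i)) w.
have IS : \int[P]_w S w = #|rat_codes n l|%:R * q ^- l.
  rewrite /S Rintegral_sum// mulr_natl -sumr_const; apply: eq_bigr => V.
  rewrite inE => /asboolP[a [d [dD _ Vd]]].
  rewrite (_ : (fun i => _) = digit_code d l); last by apply/funext.
  rewrite /Rintegral (_ : (fun w => _) = EFin \o \1_(cylinder dg l (digit_code d l)))//.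
  rewrite integral_indic// setIT.
  exact: (congr1 fine (measure_cylinder b2 iid l dD)).
have iS : P.-integrable setT (EFin \o S).
  rewrite (_ : _ \o _ = fun w => (\sum_(V in rat_codes n l)
     (\1_(cylinder dg l (fun i => V i)) w)%:E)%E).
    by apply: integrable_sum => // V _; exact: icyl.
  by apply/funext => w /=; rewrite sumEFin.
have iE := integrable_energy b2 iid n M.
rewrite -IS -RintegralZr// -RintegralZl//.
have iZ (c : R) f : P.-integrable setT (EFin \o f) ->
    P.-integrable setT (EFin \o (fun w => c * f w)).
  by move=> fi; exact: (integrableZl measurableT c fi).
apply: le_Rintegral => //.
- by under eq_fun do rewrite mulrC; exact: iZ.
- exact: iZ.
move=> w _.
have E0 : 0 <= energy R dg n M w by rewrite addr_ge0 ?sqr_ge0.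
have [V|noV] := pickP [pred V in rat_codes n l | w \in cylinder dg l (fun i => V i)].
  rewrite !inE => /andP[/asboolP[a [d [dD da Vd]]] wV].
  have -> : S w = 1.
    rewrite /S (bigD1 V) /=; last by rewrite inE; apply/asboolP; exists a, d.
    rewrite indicE wV big1 ?addr0// => V' /andP[_ VV'].
    rewrite indicE memNset//= => wV'; move: VV' => /eqP; apply.
    by apply/ffunP => i; apply/val_inj; rewrite /= -wV' (set_mem wV).
  rewrite mul1r; apply: (energy_lower (e := n%:R / b%:R ^+ l) (a := a)) => //.
  move=> i; have := @digit_series_dist R _ _ b2 (dg^~ w) d l i.
  rewrite (set_mem wV) Vd => /(_ erefl); rewrite da => h.
  rewrite (_ : _ - _ = n%:R * (digit_series R (dg^~ w) i - (a i)%:~R / n%:R)).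
    by rewrite normrM normr_nat ler_wpM2l.
  by rewrite mulrBr [n%:R * (_ / _)]mulrC divfK.
have -> : S w = 0.
  rewrite /S big1// => V VA; rewrite indicE; have := noV V.
  by rewrite /= VA /= => ->.
by rewrite mul0r mulr_ge0.
Qed.

(** The division coarsens [V] to level [l'], and [s] followed by the predecessor shifts each
    coordinate by -1, 0 or 1. Truncation at 0 merely repeats a cell. *)
Definition rat_cover (n l l' : nat) : set T :=
  \big[setU/set0]_(V in rat_codes n l) \big[setU/set0]_(s : {ffun 'I_k -> 'I_3})
     cylinder dg l' (fun i => (V i %/ b ^ (l - l') + s i).-1).

Lemma measurable_rat_cover n l l' : measurable (rat_cover n l l').
Proof.
apply: bigsetU_measurable => V _; apply: bigsetU_measurable => s _.
exact: measurable_cylinder.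
Qed.

Lemma measure_rat_cover n l l' :
  (P (rat_cover n l l') <= (#|rat_codes n l|%:R * (3 ^ k)%:R * q ^- l')%:E)%E.
Proof.
apply: (le_trans (measure_bigsetU_le _ _ _ _)) => [V|].
  by apply: bigsetU_measurable => s _; exact: measurable_cylinder.
rewrite -mulrA mulr_natl -sumr_const -sumEFin; apply: lee_sum => V _.
apply: (le_trans (measure_bigsetU_le _ _ _ _)) => [s|].
  exact: measurable_cylinder.
rewrite (_ : (3 ^ k)%:R = #|{ffun 'I_k -> 'I_3}|%:R); last first.
  by rewrite card_ffun !card_ord.
rewrite mulr_natl -sumr_const -sumEFin; apply: lee_sum => s _.
exact: measure_cylinder_le.
Qed.

Lemma mem_rat_cover n l l' w (a : 'I_k -> int) : (l' <= l)%N ->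
    MD_fractal R D (fun i => (a i)%:~R / n%:R) ->
    (forall i, `|X w i - (a i)%:~R / n%:R| < (b%:R ^+ l')^-1) ->
  rat_cover n l l' w.
Proof.
move=> l'l [d [dD da]] wa.
pose V : {ffun 'I_k -> 'I_(b ^ l)} := [ffun i => Ordinal (digit_code_lt d l i)].
have VA : V \in rat_codes n l.
  by rewrite inE; apply/asboolP; exists a, d; split => // i; rewrite ffunE.
rewrite /rat_cover (bigD1 V VA)/=; left.
pose u i := digit_code (dg^~ w) l' i; pose c i := digit_code d l' i.
have h1 i : (u i <= (c i).+1)%N.
  by apply: (digit_code_near (R := R) b2); rewrite da; exact: wa.
have h2 i : (c i <= (u i).+1)%N.
  by apply: (digit_code_near (R := R) b2); rewrite distrC da; exact: wa.
(* The witness [s = u + 1 - c] turns [(c + s).-1] into [u]; [h2] makes the subtraction exact and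
   [h1] bounds it by 2. *)
have h3 i : ((u i).+1 - c i < 3)%N by have := h1 i; lia.
pose s : {ffun 'I_k -> 'I_3} := [ffun i => Ordinal (h3 i)].
rewrite (bigD1 s)//=; left.
move=> i; rewrite !ffunE /= -[X in digit_code d X i](subnKC l'l).
by rewrite -digit_code_divn// -/(c i) -/(u i) subnKC.
Qed.

(** All denominators from 1 to [N] are taken, including those of lower levels, to match the range of
    [n] in [sum_scaled_differences]. *)
Definition block_cover (N l l' : nat) : set T :=
  \big[setU/set0]_(n < N) rat_cover n.+1 l l'.

Lemma measurable_block_cover N l l' : measurable (block_cover N l l').
Proof. by apply: bigsetU_measurable => n _; exact: measurable_rat_cover. Qed.

(** Sums [card_rat_codes] over [n] and applies [sum_scaled_differences] to [|hat mu|], which is 1 at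
    0; one of the two factors [M ^ k] cancels. *)
Lemma measure_block_cover (N M l l' : nat) (B : R) : (0 < M)%N ->
    k%:R * M%:R * (N%:R / b%:R ^+ l) <= 8^-1 :> R -> 0 <= B ->
    (forall m : nat, (0 < m <= N * M)%N -> (size (divisors m))%:R <= B) ->
  (P (block_cover N l l') <=
   (4 * (3 ^ k)%:R * (q ^+ l * q ^- l') / (M ^ k)%:R *
     (N%:R + B * l1_box_sum P X (N * M)%:R))%:E)%E.
Proof.
move=> M0 hM B0 hB.
have Mk : 0 < (M ^ k)%:R :> R by rewrite ltr0n expn_gt0 M0.
have ql : 0 < q ^+ l by rewrite exprn_gt0.
have ql' : 0 < q ^+ l' by rewrite exprn_gt0.
have c3 : 0 < (3 ^ k)%:R :> R by rewrite ltr0n expn_gt0.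
apply: (le_trans (measure_bigsetU_le _ _ _ _)) => [n|].
  exact: measurable_rat_cover.
have h (n : 'I_N) : (P (rat_cover n.+1 l l') <=
    (4 * (3 ^ k)%:R * (q ^+ l * q ^- l') / ((M ^ k)%:R ^+ 2) *
      \int[P]_w energy R dg n.+1 M w)%:E)%E.
  apply: (le_trans (measure_rat_cover _ _ _)); rewrite lee_fin.
  have /card_rat_codes : (0 < n.+1)%N by [].
  move=> /(_ l M).
  have hn : k%:R * M%:R * (n.+1%:R / b%:R ^+ l) <= 8^-1 :> R.
    by apply: le_trans hM; rewrite ler_wpM2l// ler_wpM2r// ler_nat.
  move=> /(_ hn); set I := Rintegral _ _ _; set c := #|_|%:R => h.
  have -> : c * (3 ^ k)%:R * q ^- l' = (c * q ^- l * (M ^ k)%:R ^+ 2) *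
      ((3 ^ k)%:R * (q ^+ l * q ^- l') / ((M ^ k)%:R ^+ 2)).
    by field; rewrite !gt_eqF.
  have -> : 4 * (3 ^ k)%:R * (q ^+ l * q ^- l') / (M ^ k)%:R ^+ 2 * I =
    (4 * I) * ((3 ^ k)%:R * (q ^+ l * q ^- l') / ((M ^ k)%:R ^+ 2)).
    by field; rewrite !gt_eqF.
  rewrite ler_wpM2r// divr_ge0 ?exprn_ge0 ?ltW//.
  by rewrite mulr_gt0// divr_gt0.
apply: (le_trans (lee_sum _ (fun n _ => h n))).
rewrite sumEFin lee_fin -mulr_sumr.
have hs : \sum_(n < N) \int[P]_w energy R dg n.+1 M w <=
    (M ^ k)%:R * (N%:R + B * l1_box_sum P X (N * M)%:R).
  have := @sum_scaled_differences R k N M (fourier_abs P X) B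
            (fourier_abs_ge0 P dg) B0 hB.
  rewrite fourier_abs0 mulr1 -l1_box_sum_nat; apply: le_trans.
  by apply: ler_sum => n _; exact: (Rintegral_energy_le b2 iid).
have c0 : 0 <= 4 * (3 ^ k)%:R * (q ^+ l * q ^- l') / (M ^ k)%:R ^+ 2.
  by rewrite divr_ge0 ?sqr_ge0// mulr_ge0// ltW// divr_gt0.
apply: (le_trans (ler_wpM2l c0 hs)).
rewrite le_eqVlt; apply/orP; left; apply/eqP.
by field; rewrite !gt_eqF.
Qed.

End Covering.

(** * Exponent bookkeeping, a geometric series and a finite box *)

Lemma powRDp (R : realType) (x r s : R) : 0 < x -> x `^ (r + s) = x `^ r * x `^ s.
Proof. by move=> x0; rewrite powRD// (gt_eqF x0) implybT. Qed.

(** Here [B] stands for [be ^ l]. The factor [q ^ (l - l')] contributes [de - de * (th * (1 + ta))],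
    the factor [M ^ -k] contributes [(th - 1) * k] because [M] is at least of order [B ^ (1 - th)],
    and the last factor [th + e]. *)
Lemma cover_exponent_bound (R : realType) (k N M l l' : nat)
    (be q de th ta e Cd C1 B : R) :
    1 <= B -> 0 <= e -> 0 <= Cd -> 0 <= C1 -> 0 < q -> (0 < M)%N ->
    N%:R <= be `^ th * B `^ th ->
    B <= 16 * k%:R * N%:R * M%:R ->
    q ^+ l = B `^ de -> q ^- l' <= q * B `^ (- (de * (th * (1 + ta)))) ->
  4 * (3 ^ k)%:R * (q ^+ l * q ^- l') / (M ^ k)%:R *
    (N%:R + Cd * B `^ e * (C1 * B `^ th)) <=
  4 * (3 ^ k)%:R * q * (16 * k%:R * be `^ th) ^+ k * (be `^ th + Cd * C1) *
    B `^ (de - de * (th * (1 + ta)) + (th - 1) * k%:R + (th + e)).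
Proof.
move=> B1 e0 Cd0 C10 q0 M0 hN hM hq hq'.
have B0 : 0 < B by lra.
have M0R : 0 < M%:R :> R by rewrite ltr0n.
have bt := powR_ge0 be th.
have e1 : 1 <= B `^ e by rewrite -[X in X <= _](powRr0 B) ler_powR.
have h1 : N%:R + Cd * B `^ e * (C1 * B `^ th) <= (be `^ th + Cd * C1) * B `^ (th + e).
  rewrite powRDp// mulrDl; apply: lerD; last by rewrite le_eqVlt; apply/orP; left; apply/eqP; ring.
  by apply: (le_trans hN); rewrite mulrA ler_peMr// mulr_ge0// powR_ge0.
have h2 : (M ^ k)%:R^-1 <= (16 * k%:R * be `^ th) ^+ k * B `^ ((th - 1) * k%:R).
  rewrite powRrM powR_mulrn ?powR_ge0// -exprMn natrX -exprVn.
  rewrite lerXn2r ?nnegrE ?invr_ge0 ?mulr_ge0 ?powR_ge0//.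
  rewrite -[X in X <= _]mul1r ler_pdivrMr// powRDp// powR_inv1 ?(ltW B0)//.
  rewrite [X in _ <= X](_ : _ = 16 * k%:R * (be `^ th * B `^ th) * M%:R / B); last by ring.
  rewrite ler_pdivlMr// mul1r; apply: (le_trans hM).
  by rewrite ler_wpM2r// ler_wpM2l// mulr_ge0.
have h3 : q ^+ l * q ^- l' <= q * B `^ (de - de * (th * (1 + ta))).
  by rewrite powRDp// hq mulrCA ler_wpM2l// powR_ge0.
rewrite !powRDp// in h3 *; rewrite powRDp// in h1.
set x := q ^+ l * q ^- l' in h3 *; set y := (M ^ k)%:R^-1 in h2 *.
set z := N%:R + _ in h1 *.
have x0 : 0 <= x by rewrite mulr_ge0 ?invr_ge0 ?exprn_ge0// ltW.
have y0 : 0 <= y by rewrite invr_ge0.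
have z0 : 0 <= z by rewrite addr_ge0// !mulr_ge0 ?powR_ge0.
have := ler_pM (mulr_ge0 x0 y0) z0 (ler_pM x0 y0 h3 h2) h1.
have c0 : 0 <= 4 * (3 ^ k)%:R :> R by rewrite mulr_ge0.
move=> /(ler_wpM2l c0) h; apply: le_trans (le_trans h _).
  by rewrite le_eqVlt; apply/orP; left; apply/eqP; ring.
by rewrite le_eqVlt; apply/orP; left; apply/eqP; ring.
Qed.

Lemma nneseries_geometric_lty (R : realType) (c r : R) : 0 <= c -> 0 <= r < 1 ->
  (\sum_(n <oo) (c * r ^+ n)%:E < +oo)%E.
Proof.
move=> c0 /andP[r0 r1]; have r1' : 0 < 1 - r by rewrite subr_gt0.
apply: (@le_lt_trans _ _ (c / (1 - r))%:E); last exact: ltry.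
apply: lime_le.
  by apply: is_cvg_nneseries => n _ _; rewrite lee_fin mulr_ge0// exprn_ge0.
near=> m; rewrite sumEFin lee_fin.
have -> : \sum_(0 <= n < m) c * r ^+ n = c * (1 - r ^+ m) / (1 - r).
  elim: (m) => [|j IH]; first by rewrite big_geq// expr0 subrr mulr0 mul0r.
  rewrite big_nat_recr//= IH exprS; field; exact: lt0r_neq0.
by rewrite ler_wpM2r ?invr_ge0 ?(ltW r1')// ler_piMr// gerBl exprn_ge0.
Unshelve. all: by end_near. Qed.

Lemma finite_int_box (k n0 : nat) (H : nat) :
  finite_set [set an : ('I_k -> int) * nat |
    (an.2 < n0)%N /\ forall i, (`|an.1 i|%N <= H)%N].
Proof.
pose f (p : {ffun 'I_k -> 'I_(H.*2).+1} * 'I_n0) : ('I_k -> int) * nat :=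
  (fun i => (p.1 i : nat)%:Z - H%:Z, p.2 : nat).
apply: (@sub_finite_set _ _ (f @` setT)); last exact: finite_image.
move=> [a n] /= [nn0 aH].
exists ([ffun i => inord (absz (a i + H%:Z))], Ordinal nn0) => //.
congr pair; apply/funext => i; rewrite ffunE inordK; have := aH i; lia.
Qed.

(** * Level-by-level covers and Borel-Cantelli *)

Section LimsupCover.
Context (R : realType) (k b : nat) (D : {set {ffun 'I_k -> 'I_b}}).
Context (dsp : measure_display) (T : measurableType dsp) (P : probability T R).
Context (dg : nat -> T -> {ffun 'I_k -> 'I_b}).
Hypothesis k0 : (0 < k)%N.
Hypothesis b2 : (2 <= b)%N.
Hypothesis D0 : D != finset.set0.
Hypothesis iid : iid_uniform_digits P D dg.
Let X := CL_point R dg.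
Let q : R := #|D|%:R.
Let be : R := b%:R.
Let de : R := ln q / ln be.

Let q1 : 1 <= q. Proof. by rewrite ler1n card_gt0. Qed.
Let be1 : 1 < be. Proof. by rewrite ltr1n. Qed.
Let be0 : 0 < be. Proof. exact: lt_trans be1. Qed.
Let lbe : 0 < ln be. Proof. exact: ln_gt0. Qed.

Lemma card_powR : q = be `^ de.
Proof.
rewrite /powR gt_eqF// /de divfK ?gt_eqF// lnK// posrE.
exact: lt_le_trans q1.
Qed.

Context (th ta e C1 : R).
Hypothesis th01 : 0 < th < 1.
Hypothesis ta0 : 0 <= ta.
Hypothesis thta : th * (1 + ta) <= 1.
Hypothesis e0 : 0 < e.
Hypothesis C10 : 0 <= C1.
Hypothesis hl1 : forall Q, 1 <= Q -> l1_box_sum P X Q <= C1 * Q `^ th.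
Let ex : R := de - de * (th * (1 + ta)) + (th - 1) * k%:R + (th + e).
Hypothesis expo : ex < 0.

(* The denominators [n] of level [l] are those with
   [be `^ (l * th) <= n < be `^ (l.+1 * th)]. *)
Definition max_denom (l : nat) : nat := Num.truncn (be `^ (l.+1%:R * th)).
(** Chosen so that [be ^ - coarse_level] is at least [n ^ (- 1 - ta)] for every
    [n >= be ^ (l * th)]. *)
Definition coarse_level (l : nat) : nat := Num.truncn (l%:R * (th * (1 + ta))).

Let th0 : 0 < th. Proof. by case/andP: th01. Qed.

Lemma coarse_level_le l : (coarse_level l)%:R <= l%:R * (th * (1 + ta)).
Proof. by rewrite /coarse_level truncn_le !mulr_ge0 ?addr_ge0// ltW. Qed.

Lemma coarse_level_leq l : (coarse_level l <= l)%N.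
Proof.
rewrite -(ler_nat R) (le_trans (coarse_level_le l))//.
by rewrite ler_piMr.
Qed.

Lemma max_denom_gt0 l : (0 < max_denom l)%N.
Proof.
rewrite /max_denom truncn_gt0 -[X in X <= _](powRr0 be) ler_powR ?(ltW be1)//.
by rewrite mulr_ge0 // ltW.
Qed.

Lemma max_denom_le l : (max_denom l)%:R <= be `^ th * (be ^+ l) `^ th.
Proof.
rewrite -(powR_mulrn _ (ltW be0)) -powRrM -powRDp//.
rewrite (_ : th + _ = l.+1%:R * th); last by rewrite -natr1; ring.
by rewrite truncn_le powR_ge0.
Qed.

(** Since [th < 1], denominators grow more slowly than [be ^ l]; this makes room for a kernel of
    order at least 1. *)
Lemma large_level : exists l0 : nat, forall l, (l0 <= l)%N ->
  8 * k%:R * (max_denom l)%:R <= be ^+ l.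
Proof.
have th1 : 0 < 1 - th by rewrite subr_gt0; case/andP: th01.
pose A := 8 * k%:R * be `^ th; pose y := A / ((1 - th) * ln be).
exists (Num.truncn y).+1 => l hl.
have ly : y <= l%:R.
  by apply: (le_trans (ltW (truncnS_gt y))); rewrite ler_nat.
rewrite -(powR_mulrn _ (ltW be0)).
rewrite (_ : l%:R = l%:R * th + l%:R * (1 - th)); last by ring.
rewrite powRDp// powRrM (powR_mulrn _ (ltW be0)).
have h : A <= be `^ (l%:R * (1 - th)).
  rewrite /powR gt_eqF//; apply: (le_trans _ (expR_ge1Dx _)).
  rewrite -[X in X <= _]add0r lerD//.
  by rewrite -mulrA -ler_pdivrMr// mulr_gt0.
apply: (@le_trans _ _ ((be ^+ l) `^ th * A)); last first.
  by rewrite ler_wpM2l// powR_ge0.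
rewrite [X in _ <= X](_ : _ = 8 * k%:R * (be `^ th * (be ^+ l) `^ th)).
  by rewrite ler_wpM2l ?mulr_ge0// max_denom_le.
by rewrite /A; ring.
Qed.

Lemma measure_block_cover_geometric :
  exists (l0 : nat) (C r : R), [/\ 0 <= C, 0 <= r < 1 &
    forall l, (l0 <= l)%N ->
      (P (block_cover R D dg (max_denom l) l (coarse_level l)) <= (C * r ^+ l)%:E)%E].
Proof.
have [l0 hl0] := large_level.
have [Cd [Cd0 hCd]] := size_divisors_bound e0.
exists l0, (4 * (3 ^ k)%:R * q * (16 * k%:R * be `^ th) ^+ k * (be `^ th + Cd * C1)),
  (be `^ ex); split.
- have q0 : 0 <= q by apply: le_trans q1.
  rewrite !mulr_ge0 ?exprn_ge0 ?addr_ge0 ?mulr_ge0 ?powR_ge0//.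
  exact: ltW.
- rewrite powR_ge0/= -[X in _ < X](powRr0 be) /powR gt_eqF// ltr_expR mul0r.
  by rewrite pmulr_llt0.
move=> l ll0; set N := max_denom l; pose B := be ^+ l.
have B1 : 1 <= B by rewrite exprn_ege1// ltW.
have B0 : 0 < B by lra.
have N0 : 0 < N%:R :> R by rewrite ltr0n max_denom_gt0.
have k0R : 0 < k%:R :> R by rewrite ltr0n.
pose y := B / (8 * k%:R * N%:R).
have kN : 0 < 8 * k%:R * N%:R :> R by rewrite !mulr_gt0.
have y1 : 1 <= y by rewrite ler_pdivlMr// mul1r hl0.
(* The largest order for which [k * M * (N / B) <= 1 / 8], as the kernel bound requires. *)
pose M := Num.truncn y.
have M0 : (0 < M)%N by rewrite truncn_gt0.
have M1 : 1 <= M%:R :> R by rewrite ler1n.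
have /andP[My yM] : M%:R <= y < M.+1%:R by apply: truncn_itv; lra.
have My' : M%:R * (8 * k%:R * N%:R) <= B by rewrite -ler_pdivlMr.
have yM' : B < (M%:R + 1) * (8 * k%:R * N%:R) by rewrite -ltr_pdivrMr// natr1.
have k1 : 1 <= k%:R :> R by rewrite ler1n.
have NM : (N * M)%:R <= B.
  apply: le_trans My'; rewrite natrM mulrC ler_wpM2l// ler_peMl//; lra.
have NM1 : 1 <= (N * M)%:R :> R.
  by rewrite ler1n muln_gt0 M0 max_denom_gt0.
have hB (m : nat) : (0 < m <= N * M)%N -> (size (divisors m))%:R <= Cd * B `^ e.
  move=> /andP[m0 mNM]; apply: (le_trans (hCd _ m0)).
  rewrite ler_wpM2l ?(ltW Cd0)// ge0_ler_powR ?nnegrE ?(ltW e0) ?(ltW B0)//.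
  by apply: le_trans NM; rewrite ler_nat.
have hM : k%:R * M%:R * (N%:R / be ^+ l) <= 8^-1.
  by rewrite mulrA ler_pdivrMr// -/B; lra.
have CdB : 0 <= Cd * B `^ e by rewrite mulr_ge0 ?powR_ge0// ltW.
apply: (le_trans (measure_block_cover b2 D0 iid (coarse_level l) M0 hM CdB hB)).
rewrite lee_fin.
have hl : l1_box_sum P X (N * M)%:R <= C1 * B `^ th.
  apply: (le_trans (hl1 NM1)); rewrite ler_wpM2l//.
  by rewrite ge0_ler_powR ?nnegrE ?(ltW th0) ?(ltW B0).
have q0 : 0 < q by apply: lt_le_trans q1.
have step : 4 * (3 ^ k)%:R * (q ^+ l * q ^- coarse_level l) / (M ^ k)%:R *
    (N%:R + Cd * B `^ e * l1_box_sum P X (N * M)%:R) <=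
  4 * (3 ^ k)%:R * (q ^+ l * q ^- coarse_level l) / (M ^ k)%:R *
    (N%:R + Cd * B `^ e * (C1 * B `^ th)).
  rewrite ler_wpM2l//; last by rewrite lerD2l ler_wpM2l.
  by rewrite !mulr_ge0// ?invr_ge0 ?exprn_ge0// ltW.
apply: (le_trans step).
have := @cover_exponent_bound R k N M l (coarse_level l) be q de th ta e Cd C1 B
  B1 (ltW e0) (ltW Cd0) C10 q0 M0 (max_denom_le l).
(* Rounding [y >= 1] down loses at most a factor 2, whence 16 in place of 8. *)
have h16 : B <= 16 * k%:R * N%:R * M%:R by nra.
have hql : q ^+ l = B `^ de.
  rewrite {1}card_powR -powR_mulrn ?powR_ge0// -powRrM mulrC powRrM.
  by rewrite powR_mulrn// ltW.
(* The extra factor [q] pays for the rounding in [coarse_level]. *)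
have hql' : q ^- coarse_level l <= q * B `^ (- (de * (th * (1 + ta)))).
  rewrite powRN -/(_ / _) ler_pdivlMr ?powR_gt0// mulrC ler_pdivrMr ?exprn_gt0//.
  rewrite -exprS -powR_mulrn ?(ltW q0)//.
  rewrite powRrM -hql -(powR_mulrn _ (ltW q0)) -powRrM ler_powR//.
  by rewrite ltW// /coarse_level truncnS_gt.
move=> /(_ h16 hql hql'); rewrite -/ex.
rewrite (_ : B `^ ex = be `^ ex ^+ l)//.
by rewrite -(powR_mulrn _ (powR_ge0 _ _)) -powRrM mulrC powRrM powR_mulrn// ltW.
Qed.

(** For [x] in the unit cube the numerators satisfy [|a i| <= n + 1], so only finitely many
    solutions have [n < n0]. *)
Lemma W_set_large_denom (tau : R) x (n0 : nat) : 0 <= tau ->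
    W_set (MD_fractal R D) tau x ->
  exists (a : 'I_k -> int) (n : nat), [/\ (n0 <= n)%N, (0 < n)%N,
    MD_fractal R D (fun i => (a i)%:~R / n%:R) &
    forall i, `|x i - (a i)%:~R / n%:R| < n%:R `^ (- tau) / n%:R].
Proof.
move=> tau0 [x01 xinf]; apply: contrapT => hno; apply: xinf.
apply: sub_finite_set (finite_int_box k n0 n0.+1) => -[a n] /= [n_gt0 [Ka xa]].
have nn0 : (n < n0)%N.
  by rewrite ltnNge; apply/negP => n0n; apply: hno; exists a, n.
split => // i.
have nR : 0 < n%:R :> R by rewrite ltr0n.
have ntau : n%:R `^ (- tau) <= 1.
  by rewrite -[X in _ <= X](powRr0 n%:R) ler_powR ?ler1n// oppr_le0.
have /andP[x0 x1] := x01 i; have := xa i.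
rewrite ltr_pdivlMr// -[X in _ * X](ger0_norm (ltW nR)) -normrM mulrBl divfK ?gt_eqF//.
move=> h; have {}h : `|x i * n%:R - (a i)%:~R| < 1 by exact: lt_le_trans ntau.
have xn : `|x i * n%:R| <= n%:R.
  by rewrite normrM (ger0_norm x0) (ger0_norm (ltW nR)) ler_piMl// ltW.
have : `|(a i)%:~R| <= n.+1%:R :> R.
  rewrite -natr1; have := ler_normB (x i * n%:R) (x i * n%:R - (a i)%:~R).
  by rewrite subKr => /le_trans; apply; rewrite lerD// ltW.
rewrite -intr_norm -[n.+1%:R]/(n.+1%:Z%:~R) ler_int => aN.
by apply: (@leq_trans n.+1); [rewrite -lez_nat abszE|exact: leqW].
Qed.

Lemma W_set_block_cover (tau : R) w (L : nat) : ta <= tau ->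
    W_set (MD_fractal R D) tau (X w) ->
  exists2 l, (L <= l)%N &
    block_cover R D dg (max_denom l) l (coarse_level l) w.
Proof.
move=> tatau Xw; pose n0 := (Num.truncn (be `^ (L%:R * th))).+1.
have [a [n [n0n n_gt0 Ka Xa]]] := W_set_large_denom n0 (le_trans ta0 tatau) Xw.
have nR : 0 < n%:R :> R by rewrite ltr0n.
have n1 : 1 <= n%:R :> R by rewrite ler1n.
have thl : 0 < th * ln be by rewrite mulr_gt0.
(* The level with [be ^ (l * th) <= n < be ^ (l.+1 * th)]; the choice of [n0] forces [L <= l]. *)
pose l := Num.truncn (ln n%:R / (th * ln be)).
have y0 : 0 <= ln n%:R / (th * ln be) :> R by rewrite divr_ge0 ?ln_ge0// ltW.
have /andP[ly yl] := truncn_itv y0; rewrite -/l in ly yl.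
rewrite ler_pdivlMr// in ly; rewrite ltr_pdivrMr// in yl.
have beE y : be `^ y = expR (y * ln be) by rewrite /powR gt_eqF.
have nE : n%:R = expR (ln n%:R) :> R by rewrite lnK.
have nl : be `^ (l%:R * th) <= n%:R by rewrite beE nE ler_expR -mulrA.
exists l.
  rewrite /l truncn_ge_nat// ler_pdivlMr// mulrA.
  rewrite -ler_expR -beE -nE.
  by apply: (le_trans (ltW (truncnS_gt _))); rewrite ler_nat.
have nN : (n <= max_denom l)%N.
  rewrite /max_denom truncn_ge_nat ?powR_ge0//.
  by rewrite beE nE ler_expR -mulrA ltW.
have n1N : (n.-1 < max_denom l)%N by rewrite prednK.
rewrite /block_cover (bigD1 (Ordinal n1N))//=; left; rewrite prednK//.
apply: (mem_rat_cover b2 D0 (a := a)) => //; first exact: coarse_level_leq.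
move=> i; apply: (lt_le_trans (Xa i)).
rewrite -[X in _ / X](powRr1 (ltW nR)) -powRN -powRDp//.
apply: (@le_trans _ _ (n%:R `^ (- (1 + ta)))).
  by rewrite ler_powR//; lra.
rewrite powRN lef_pV2 ?posrE ?powR_gt0 ?exprn_gt0//.
apply: (@le_trans _ _ ((be `^ (l%:R * th)) `^ (1 + ta))); last first.
  by rewrite ge0_ler_powR ?nnegrE ?powR_ge0 ?addr_ge0 ?(ltW nR).
rewrite -powRrM -mulrA -(powR_mulrn _ (ltW be0)) ler_powR ?(ltW be1)//.
exact: coarse_level_le.
Qed.

Lemma negligible_W_set (tau : R) : ta <= tau ->
  P.-negligible (X @^-1` W_set (MD_fractal R D) tau).
Proof.
move=> tatau; have [l0 [C [r [C0 r01 hP]]]] := measure_block_cover_geometric.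
(* The shift by [l0] discards the levels where the geometric bound is not yet available. *)
pose F j := block_cover R D dg (max_denom (j + l0)) (j + l0) (coarse_level (j + l0)).
have mF j : measurable (F j) by exact: (measurable_block_cover b2 iid).
have r0 : 0 <= r by case/andP: r01.
exists (lim_sup_set F); split.
- by apply: bigcap_measurable => // n _; exact: bigcup_measurable.
- apply: lim_sup_set_cvg0 => //.
  apply: le_lt_trans (nneseries_geometric_lty C0 r01).
  apply: lee_nneseries => // j _; apply: (le_trans (hP _ (leq_addl _ _))).
  rewrite lee_fin ler_wpM2l// exprD ler_piMr ?exprn_ge0// exprn_ile1//.
  by apply: ltW; case/andP: r01.
move=> w Xw L _; have [l Ll wl] := W_set_block_cover (L + l0) tatau Xw.
have l0l : (l0 <= l)%N := leq_trans (leq_addl _ _) Ll.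
by exists (l - l0)%N; [rewrite /= leq_subRL// addnC|rewrite /F subnK].
Qed.

End LimsupCover.

(** * From the hypotheses on [mu] and the fractal to the choice of exponents *)

Lemma dim_l1_exponent (R : realType) (dsp : measure_display)
    (T : measurableType dsp) (P : probability T R) (k : nat) (X : T -> 'I_k -> R) :
    (0 < k)%N -> k%:R - k%:R / k.+1%:R < dim_l1 P X ->
  exists th C : R, [/\ 0 < th < k%:R / k.+1%:R, 0 <= C &
    forall Q, 1 <= Q -> l1_box_sum P X Q <= C * Q `^ th].
Proof.
move=> k0; rewrite /dim_l1; set S := [set s | _] => hS.
have kR : 0 < k%:R :> R by rewrite ltr0n.
have kk : 0 < k%:R / k.+1%:R :> R by rewrite divr_gt0.
have k1 : k%:R / k.+1%:R <= k%:R :> R.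
  by rewrite ler_pdivrMr// ler_peMr// ler1n.
have [s [s0 [C hC]] ks] : exists2 s, S s & k%:R - k%:R / k.+1%:R < s.
  have [supS|nsup] := pselect (has_sup S).
    by apply: sup_gt => //; case: supS.
  (* Without a supremum, [sup] defaults to 0, contradicting [k / (k + 1) <= k]. *)
  by exfalso; move: hS; rewrite sup_out// subr_lt0 ltNge k1.
have C0 : 0 <= C.
  have := hC 1 (lexx _); rewrite powR1 mulr1; apply: le_trans.
  by apply: sumr_ge0 => xi _; exact: sqrtr_ge0.
move: kk ks; move: (k%:R / k.+1%:R) => x kk ks.
(* An admissible [s] may reach or exceed [k]; the maximum keeps [th] positive, and raising [th] only
   weakens the bound for [Q >= 1]. *)
exists (Num.max (k%:R - s) (x / 2)), C; split => //.
  by rewrite lt_max gt_max; apply/andP; split; [apply/orP; right|apply/andP; split]; lra.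
move=> Q Q1; apply: (le_trans (hC Q Q1)); rewrite ler_wpM2l// ler_powR//.
by rewrite le_max lexx.
Qed.

(** Two distinct points exclude [k = 0], and being other than the cube excludes the full digit
    set. *)
Lemma proper_fractal_card (R : realType) (k b : nat) (D : {set {ffun 'I_k -> 'I_b}}) :
  (2 <= b)%N -> proper_fractal (MD_fractal R D) -> (0 < k)%N /\ (#|D| < b ^ k)%N.
Proof.
move=> b2 [[x [y [_ [_ xy]]]] Kne]; split.
  rewrite lt0n; apply/eqP => k0; apply: xy; apply/funext => i.
  by have := ltn_ord i; rewrite [X in (_ < X)%N]k0.
have cardT : #|[set: {ffun 'I_k -> 'I_b}]%SET| = (b ^ k)%N.
  by rewrite cardsT card_ffun !card_ord.
rewrite -cardT proper_card// finset.properT; apply/eqP => DT.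
by apply: Kne; rewrite DT MD_fractal_setT.
Qed.

Theorem theorem1p17 (R : realType) (k b : nat) (D : {set {ffun 'I_k -> 'I_b}})
    (dsp : measure_display) (T : measurableType dsp) (P : probability T R)
    (dg : nat -> T -> {ffun 'I_k -> 'I_b}) :
  (2 <= b)%N -> D != finset.set0 ->
  proper_fractal (MD_fractal R D) ->
  iid_uniform_digits P D dg ->
  k%:R - k%:R / (k.+1)%:R < dim_l1 P (CL_point R dg) ->
  exists eps : R, 0 < eps /\
    forall tau : R, (k%:R)^-1 - eps < tau ->
      P.-negligible (CL_point R dg @^-1` W_set (MD_fractal R D) tau).
Proof.
move=> b2 D0 Kproper iid hdim.
have [k0 Dk] := proper_fractal_card b2 Kproper.
have [th [C1 [/andP[th0 thk] C10 hl1]]] := dim_l1_exponent k0 hdim.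
have kR : 1 <= k%:R :> R by rewrite ler1n.
pose de : R := ln #|D|%:R / ln b%:R.
have lb : 0 < ln b%:R :> R by rewrite ln_gt0// ltr1n.
have D1 : 1 <= #|D|%:R :> R by rewrite ler1n card_gt0.
have de0 : 0 <= de by apply: divr_ge0; [exact: ln_ge0|exact: ltW].
have dek : de < k%:R.
  rewrite ltr_pdivrMr// mulrC mulr_natr -lnXn; last by rewrite ltr0n (ltn_trans _ b2).
  rewrite ltr_ln ?posrE ?exprn_gt0 ?ltr0n ?card_gt0//; last exact: ltn_trans b2.
  by rewrite -natrX ltr_nat.
set K : R := k%:R in kR dek thk *.
have thK : th * (K + 1) < K.
  by move: thk; rewrite ltr_pdivlMr// -natr1.
pose v := 1 - th * (K + 1) / K.
have K0 : 0 < K by lra.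
have vE : th * (K + 1) = (1 - v) * K by rewrite /v; field; lra.
have v0 : 0 < v by rewrite /v subr_gt0 ltr_pdivrMr// mul1r.
have v1 : v <= 1 by rewrite /v gerBl divr_ge0// ?mulr_ge0//; lra.
have th1 : th < 1 by nra.
(* With [v] the relative gap between [th] and [k / (k + 1)], [- eta] is the total exponent at
   [tau = 1 / k] and [e = 0]. *)
pose eta := (K - de) * v.
have eta0 : 0 < eta by rewrite mulr_gt0// subr_gt0.
have etaK : eta <= K by rewrite /eta; nra.
(* Lowering [tau] by [eps] costs [de * th * eps <= eta / 4], and the divisor exponent is set to
   [eta / 4], so at least half of [eta] survives. As [eta <= K], also [eps <= 1 / K]. *)
pose eps := eta / (4 * K ^+ 2).
have eps0 : 0 < eps by rewrite divr_gt0// mulr_gt0// exprn_gt0.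
have epsE : eps * K * K = eta / 4 by rewrite /eps; field; lra.
have epsK : eps * K <= eta / 4 by rewrite -epsE ler_peMr// mulr_ge0// ltW.
exists eps; split=> // tau htau.
have KV : K * K^-1 = 1 by rewrite divff// gt_eqF.
have KV0 : 0 < K^-1 by rewrite invr_gt0.
have ta0 : 0 <= K^-1 - eps.
  rewrite subr_ge0 -[X in _ <= X]mul1r ler_pdivlMr//; nra.
have thta : th * (1 + (K^-1 - eps)) = 1 - v - th * eps.
  have -> : 1 - v = th * (K + 1) / K by rewrite vE mulfK// gt_eqF.
  by field; lra.
(* The cover is built once for [ta = 1 / k - eps] and serves every larger [tau]. *)
apply: (negligible_W_set (th := th) (ta := K^-1 - eps) (e := eta / 4) (C1 := C1)
          k0 b2 D0 iid) => //.
- by rewrite th0.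
- by rewrite thta; nra.
- by rewrite divr_gt0.
- rewrite -/de -/K thta.
  have h : de * (th * eps) <= eta / 4.
    apply: le_trans epsK; rewrite mulrA mulrC ler_wpM2l ?(ltW eps0)//.
    by apply: (@le_trans _ _ (de * 1)); [rewrite ler_wpM2l// ltW|lra].
  have -> : de - de * (1 - v - th * eps) + (th - 1) * K + (th + eta / 4) =
    de * v + de * (th * eps) + (th * (K + 1) - K) + eta / 4 by ring.
  rewrite vE.
  have -> : de * v + de * (th * eps) + ((1 - v) * K - K) + eta / 4 =
     de * (th * eps) - 3 * eta / 4 by rewrite /eta; field.
  lra.
- exact: ltW.
Qed.
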